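(* Let $\rho\subset\mathbb{Z}_+^d$ be the shape of some $d$-dimensional partition and let $n\in\mathbb{N}$. The map $\Phi:A\mapsto G$ (last passage matrix) restricts to a bijection between $\mathcal{M}(\rho,n)$ and $\mathcal{P}(\rho,n)$.
   Context: A $d$-dimensional $\mathbb{N}$-matrix is an array $A=(a_{\mathbf{i}})_{\mathbf{i}\in\mathbb{Z}_+^d}$ of nonnegative integers with finitely many nonzero entries. A $d$-dimensional partition is such an array $\pi$ with $\pi_{\mathbf{i}}\ge\pi_{\mathbf{j}}$ whenever $\mathbf{i}\le\mathbf{j}$ componentwise; $\mathcal{P}^{(d)}$ is their set; its shape is $\mathrm{sh}(\pi)=\{\mathbf{i}:\pi_{\mathbf{i}}>0\}$. A shape of a $d$-dimensional partition is a finite downward-closed subset of $\mathbb{Z}_+^d$. A directed lattice path uses only steps $\mathbf{i}\to\mathbf{i}+\mathbf{e}_\ell$, $\ell\in[d]$. For $A$, the last passage times are $G_{\mathbf{i}}=\max_{\Pi}\sum_{\mathbf{j}\in\Pi}a_{\mathbf{j}}$, maximum over directed lattice paths $\Pi$ starting at $\mathbf{i}$ (going off to infinity); then $G=(G_{\mathbf{i}})$ is a $d$-dimensional partition and $\Phi(A):=G$. Define $\mathcal{P}(\rho,n)=\{\pi\in\mathcal{P}^{(d)}:\mathrm{sh}(\pi)\subseteq\rho,\ \pi_{1,\ldots,1}\le n\}$ and $\mathcal{M}(\rho,n)=\{A: a_{\mathbf{i}}>0\Rightarrow\mathbf{i}\in\rho,\ G_{1,\ldots,1}\le n\}$. *)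

(* Defs.v *)
From HB Require Import structures.
From mathcomp Require Import all_boot all_order.
From mathcomp Require Import all_classical.

Set Implicit Arguments.
Unset Strict Implicit.
Unset Printing Implicit Defensive.

Local Open Scope classical_set_scope.

(* Z_+ is the set of positive integers: the least index is (1, ..., 1). *)
Definition posint := {m : nat | 0 < m}.

Definition posint_one : posint := exist _ 1 isT.

Definition posint_succ (m : posint) : posint := exist _ (val m).+1 isT.

Notation idx d := {ffun 'I_d -> posint}.

Notation array d := (idx d -> nat).

Definition ones (d : nat) : idx d := [ffun=> posint_one].

Definition idx_le (d : nat) (i j : idx d) : Prop :=
  forall k : 'I_d, val (i k) <= val (j k).

(* i + e_l *)
Definition idx_step (d : nat) (i : idx d) (l : 'I_d) : idx d :=
  [ffun k => if k == l then posint_succ (i k) else i k].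

Definition Nmatrix (d : nat) : set (array d) :=
  [set A | finite_set [set i | 0 < A i]].

Definition dpartition (d : nat) : set (array d) :=
  [set p | Nmatrix p /\ forall i j, idx_le i j -> p j <= p i].

Definition sh (d : nat) (p : array d) : set (idx d) := [set i | 0 < p i].

Definition is_shape (d : nat) (rho : set (idx d)) : Prop :=
  exists2 p : array d, dpartition p & rho = sh p.

(* Directed paths are infinite; such a path is represented by the sequence of
   its vertices. *)
Definition directed_path (d : nat) (i : idx d) : set (nat -> idx d) :=
  [set w | w 0 = i /\ forall t, exists l, w t.+1 = idx_step (w t) l].

(* The summation is over the set of vertices of the path; it is a genuine sum
   as soon as A has finite support (a non-finitely supported \big is 0). *)
Definition path_weight (d : nat) (A : array d) (w : nat -> idx d) : nat :=
  \big[addn/0]_(j \in range w) A j.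

Definition is_maximum (S : set nat) (m : nat) : Prop :=
  S m /\ forall x, S x -> x <= m.

(* G_i; the default value 0 is only taken when there is no maximum, which does
   not happen for an N-matrix in dimension d > 0 (last_passage_max). *)
Definition last_passage (d : nat) (A : array d) (i : idx d) : nat :=
  xget 0 (is_maximum [set path_weight A w | w in directed_path i]).

Definition Phi (d : nat) (A : array d) : array d := last_passage A.

Definition bounded_partitions (d : nat) (rho : set (idx d)) (n : nat) :
    set (array d) :=
  [set p | [/\ dpartition p, sh p `<=` rho & p (ones d) <= n]].

Definition bounded_matrices (d : nat) (rho : set (idx d)) (n : nat) :
    set (array d) :=
  [set A | [/\ Nmatrix A, forall i, 0 < A i -> rho i
             & last_passage A (ones d) <= n]].

Lemma last_passage_max (d : nat) (A : array d) (i : idx d) :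
  0 < d -> Nmatrix A ->
  is_maximum [set path_weight A w | w in directed_path i] (last_passage A i).
Proof.
move=> d0 finA; rewrite /last_passage.
set S := [set path_weight A w | w in directed_path i].
pose tot := \big[addn/0]_(j \in setT) A j.
have fin (D : set (idx d)) : finite_set (D `&` A @^-1` [set~ 0]).
  by apply: sub_finite_set finA => j [_] /= /eqP; rewrite lt0n.
have S_le x : S x -> x <= tot.
  move=> [w _ <-]; rewrite /path_weight /tot.
  apply: (uniq_sub_le_big (op := addn) (le := leq) leqnn) => [a b|||] //.
    exact: leq_addr.
  move=> j; rewrite !in_finite_support // !inE => -[_ ?].
  by split.
have S_ne : exists x, `[< S x >].
  pose w t := iter t (fun j : idx d => idx_step j (Ordinal d0)) i.
  exists (path_weight A w); apply/asboolP; exists w => //.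
  by split=> // t; exists (Ordinal d0).
have S_ub x : `[< S x >] -> x <= tot by move=> /asboolP /S_le.
case: (ex_maxnP S_ne S_ub) => m /asboolP Sm m_max.
by apply: (xgetPex 0); exists m; split=> // x Sx; apply/m_max/asboolP.
Qed.

(* Main.v *)
Require Import Defs.
From HB Require Import structures.
From mathcomp Require Import all_boot all_order.
From mathcomp Require Import all_classical.
From mathcomp Require Import zify.

(* The last passage times satisfy G_i = a_i + max_l G_(i + e_l), because a path
   from i consists of i and of a path from some i + e_l. This determines A from
   G, and, by descending induction on the sum of the coordinates of i, it
   determines G among the finitely supported arrays from A. The inverse of Phi
   is therefore a_i = p_i - max_l p_(i + e_l), which is nonnegative for a
   partition p. *)

Set Implicit Arguments.
Unset Strict Implicit.
Unset Printing Implicit Defensive.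

Local Open Scope classical_set_scope.

Definition idx_sum (d : nat) (i : idx d) : nat := \sum_(k < d) val (i k).

Definition next_max (d : nat) (p : array d) (i : idx d) : nat :=
  \max_(l < d) p (idx_step i l).

Lemma idx_sum_step (d : nat) (i : idx d) (l : 'I_d) :
  idx_sum (idx_step i l) = (idx_sum i).+1.
Proof.
rewrite /idx_sum (bigD1 l) //= [in RHS](bigD1 l) //= ffunE eqxx /= addSn.
by congr (_ + _).+1; apply: eq_bigr => k /negPf kl; rewrite ffunE kl.
Qed.

Lemma idx_le_step (d : nat) (i : idx d) (l : 'I_d) : idx_le i (idx_step i l).
Proof. by move=> k; rewrite ffunE; case: eqP => //= _; apply: leqnSn. Qed.

Lemma idx_le_neq_step (d : nat) (i j : idx d) :
  idx_le i j -> i <> j -> exists l, idx_le (idx_step i l) j.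
Proof.
move=> ij neq.
have [[l il_lt]|all_ge] := pselect (exists l, val (i l) < val (j l)).
  exists l => k; rewrite ffunE.
  by case: eqP => [->|_] //; apply: ij.
case: neq; apply/ffunP => k; apply/val_inj/eqP; rewrite eqn_leq ij /= leqNgt.
by apply/negP => lt; apply: all_ge; exists k.
Qed.

Lemma idx_le_sum (d : nat) (i j : idx d) : idx_le i j -> idx_sum i <= idx_sum j.
Proof. by move=> ij; apply: leq_sum => k _; apply: ij. Qed.

(** Any [i] below [j] reaches [j] by unit steps that stay below [j]; the gap between the coordinate
    sums drops by one at each step and serves as the induction measure. *)
Lemma step_antitone (d : nat) (p : array d) :
  (forall i l, p (idx_step i l) <= p i) ->
  forall i j, idx_le i j -> p j <= p i.
Proof.
move=> stp i j; have [m] := ubnP (idx_sum j - idx_sum i).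
elim: m i => // m IH i lt ij.
have [->//|neq] := pselect (i = j).
have [l lj] := idx_le_neq_step ij neq.
apply: leq_trans (stp i l); apply: IH => //.
by move: lt (idx_le_sum lj); rewrite idx_sum_step; lia.
Qed.

Lemma finite_set_idx_sum_bounded (d : nat) (D : set (idx d)) :
  finite_set D -> exists N, forall i, D i -> idx_sum i < N.
Proof.
move=> /finite_seqP[s ->]; exists (\max_(i <- s) idx_sum i).+1 => i /= si.
by rewrite ltnS; apply: leq_bigmax_seq.
Qed.

(** Finite support supplies the base case: both arrays vanish once the coordinate sum reaches
    [N + M]. Without it uniqueness fails for positive [d], since every constant array solves the
    recurrence with [A = 0]. *)
Lemma next_max_recurrence_unique (d : nat) (A p q : array d) :
  Nmatrix p -> Nmatrix q ->
  (forall i, p i = A i + next_max p i) ->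
  (forall i, q i = A i + next_max q i) -> p = q.
Proof.
move=> /finite_set_idx_sum_bounded[N pN] /finite_set_idx_sum_bounded[M qM] recp recq.
apply/funext => i; have [m] := ubnP (N + M - idx_sum i).
elim: m i => // m IH i lt.
have [le|gt] := leqP (N + M) (idx_sum i).
  have -> : p i = 0 by apply/eqP; rewrite -leqn0 leqNgt; apply/negP => /pN; lia.
  by apply/esym/eqP; rewrite -leqn0 leqNgt; apply/negP => /qM; lia.
rewrite recp recq /next_max; congr (_ + _); apply: eq_bigr => l _; apply: IH.
by rewrite idx_sum_step; lia.
Qed.

Lemma directed_path_sum (d : nat) (i : idx d) (w : nat -> idx d) t :
  directed_path i w -> idx_sum (w t) = idx_sum i + t.
Proof.
move=> [w0 wS]; elim: t => [|t IH]; first by rewrite w0 addn0.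
by have [l ->] := wS t; rewrite idx_sum_step IH addnS.
Qed.

Lemma directed_path_le (d : nat) (i : idx d) (w : nat -> idx d) t :
  directed_path i w -> idx_le i (w t).
Proof.
move=> [w0 wS]; elim: t => [|t IH] k; first by rewrite w0.
by have [l ->] := wS t; apply: leq_trans (IH k) _; apply: idx_le_step.
Qed.

Lemma directed_path_tail (d : nat) (i : idx d) (w : nat -> idx d) :
  directed_path i w -> exists l, directed_path (idx_step i l) (w \o succn).
Proof.
move=> [w0 wS]; have [l wl] := wS 0; exists l; split; first by rewrite /= wl w0.
by move=> t; have [k] := wS t.+1; exists k.
Qed.

Lemma path_weight_tail (d : nat) (A : array d) (i : idx d) (w : nat -> idx d) :
  Nmatrix A -> directed_path i w ->
  path_weight A w = A i + path_weight A (w \o succn).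
Proof.
move=> finA wi; rewrite /path_weight.
have -> : range w = i |` range (w \o succn).
  apply/seteqP; split=> [_ [[|t] _ <-]|j [->|[t _ <-]]].
  - by left; case: wi.
  - by right; exists t.
  - by exists 0 => //; case: wi.
  - by exists t.+1.
(* The range of a path is infinite, while splitting the sum over a disjoint union needs finite sets.
   The tail is therefore cut down to the support of [A], which changes neither sum. *)
set T := range (w \o succn); pose T' := T `&` [set j | 0 < A j].
have A0 j : ~ T' j -> T j -> A j = 0.
  by move=> nT' Tj; apply/eqP; rewrite -leqn0 leqNgt; apply/negP => ?; apply: nT'.
rewrite -(@fsbig_widen _ _ _ _ (i |` T')); first last.
- by move=> j [[->|Tj] nj]; [case: nj; left|apply: A0 => // ?; apply: nj; right].
- by move=> j [->|[Tj _]]; [left|right].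
rewrite -(@fsbig_widen _ _ _ _ T' T); first last.
- by move=> j [Tj nj]; apply: A0.
- by move=> j [].
rewrite fsbigU0 ?fsbig_set1 //.
- exact: finite_setIr.
(* The path never returns to [i], because the coordinate sum grows along it; so [A i] is counted
   only once. *)
- move=> _ [-> [[t _ /(congr1 (@idx_sum d)) /=]]].
  by rewrite (directed_path_sum _ wi); lia.
Qed.

Lemma directed_path_cons (d : nat) (i : idx d) (l : 'I_d) (w : nat -> idx d) :
  directed_path (idx_step i l) w ->
  directed_path i (fun t => if t is t'.+1 then w t' else i).
Proof. by move=> [w0 wS]; split=> // -[|t]; [exists l|apply: wS]. Qed.

Lemma last_passage_recurrence (d : nat) (A : array d) (i : idx d) :
  0 < d -> Nmatrix A ->
  last_passage A i = A i + next_max (last_passage A) i.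
Proof.
move=> d0 finA; have [[w wi Gw] Gmax] := last_passage_max i d0 finA.
apply/eqP; rewrite eqn_leq; apply/andP; split.
  rewrite -Gw (path_weight_tail finA wi) leq_add2l.
  have [l wl] := directed_path_tail wi.
  apply: leq_trans (leq_bigmax l).
  by apply: (last_passage_max _ d0 finA).2; exists (w \o succn).
(* Conversely, [0 < d] makes the maximum over [l] attained, and putting [i] in front of an optimal
   path from that neighbour gives a path from [i]. *)
have [l lmax] : {l | next_max (last_passage A) i =
    last_passage A (idx_step i l)}.
  by apply: eq_bigmax; rewrite card_ord.
rewrite lmax; have [[v vl <-] _] := last_passage_max (idx_step i l) d0 finA.
have vi := directed_path_cons vl.
have := path_weight_tail finA vi; rewrite /comp /= => <-.
by apply: Gmax; eexists; first exact: vi.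
Qed.

(** If the time at [i] is positive, an optimal path from [i] meets a positive entry of [A]. That
    entry lies in [rho] and above [i], so [i] is in [rho] by downward closure. *)
Lemma sh_last_passage (d : nat) (A : array d) (rho : set (idx d)) :
  0 < d -> Nmatrix A -> is_shape rho -> (forall i, 0 < A i -> rho i) ->
  sh (last_passage A) `<=` rho.
Proof.
move=> d0 finA [p [_ pmon] ->] Arho i; rewrite /sh /=.
have [[w wi <-] _] := last_passage_max i d0 finA.
have [[t At]|noA] := pselect (exists t, 0 < A (w t)).
  by move=> _; apply: leq_trans (Arho _ At) (pmon _ _ (directed_path_le t wi)).
rewrite /path_weight fsbig1 // => _ [t _ <-].
by apply/eqP; rewrite -leqn0 leqNgt; apply/negP => At; apply: noA; exists t.
Qed.

Lemma finite_shape (d : nat) (rho : set (idx d)) : is_shape rho -> finite_set rho.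
Proof. by move=> [p [finp _] ->]. Qed.

Theorem theorem3p1 (d : nat) (hd : 0 < d) (rho : set (idx d)) (n : nat)
  (hrho : is_shape rho) :
  set_bij (bounded_matrices rho n) (bounded_partitions rho n) (@Phi d).
Proof.
split=> [A [finA Arho An]|A B|p [[finp pmon] prho pn]].
- have subG := sh_last_passage hd finA hrho Arho.
  split=> //; split; first exact: sub_finite_set subG (finite_shape hrho).
  apply: step_antitone => i l; rewrite /Phi [leqRHS]last_passage_recurrence //.
  by apply: leq_trans (leq_addl _ _); apply: leq_bigmax.
- rewrite !inE => -[finA _ _] [finB _ _] eqG; apply/funext => i.
  (* Once both sides are expanded by the recurrence, the [next_max] terms coincide and cancel. *)
  have := congr1 (fun G => G i) eqG.
  rewrite /Phi /= !last_passage_recurrence // -/(Phi A) -/(Phi B) eqG.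
  exact: addIn.
- pose A i := p i - next_max p i.
  (* The subtraction in [A] is never truncated, because [p] decreases along unit steps. *)
  have pA i : p i = A i + next_max p i.
    rewrite subnK //; apply/bigmax_leqP => l _.
    by apply: pmon; apply: idx_le_step.
  have supA i : 0 < A i -> 0 < p i by move=> ?; rewrite pA ltn_addr.
  have finA : Nmatrix A by apply: sub_finite_set finp => i; apply: supA.
  have Arho i : 0 < A i -> rho i by move=> /supA /prho.
  have GA : last_passage A = p.
    apply: (@next_max_recurrence_unique _ A) => // [|i].
      apply: sub_finite_set (finite_shape hrho).
      exact: sh_last_passage hd finA hrho Arho.
    exact: last_passage_recurrence.
  by exists A => //; split=> //; rewrite GA.
Qed.
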